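(* Let $A,B\in\mathbb{C}^{n\times n}$. Then the matrix $A^{(B)}$ is the unique solution $X$ of the system $$XA=(ABB^\dagger)^\dagger A\quad\text{and}\quad R(X^* )\subset R(AB).$$
   Context: $R(M)$, $M^*$, $M^\dagger$ denote the range, conjugate transpose and Moore-Penrose inverse of a complex matrix $M$. For $A,B\in\mathbb{C}^{n\times n}$, the generalized inverse of $A$ with respect to $B$ is $A^{(B)}:=(ABB^\dagger)^\dagger$. *)

(* Defs.v *)
From mathcomp Require Export all_boot all_order all_algebra.
From mathcomp Require Export sesquilinear spectral complex.
From mathcomp Require Export mathcomp_extra boolp classical_sets reals.

Set Implicit Arguments.
Unset Strict Implicit.
Unset Printing Implicit Defensive.
Import Order.TTheory GRing.Theory Num.Theory.

Local Open Scope classical_set_scope.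
Local Open Scope ring_scope.
Local Open Scope sesquilinear_scope.

(* MathComp's own row-space machinery acts on row vectors; this is the usual
   range (column space) [{M v | v}], as a set of column vectors. *)
Definition mxrange (C : numClosedFieldType) (m n : nat) (M : 'M[C]_(m, n)) :
    set 'cV[C]_m :=
  range (fun v : 'cV[C]_n => M *m v).

Definition is_MP (C : numClosedFieldType) (m n : nat)
    (M : 'M[C]_(m, n)) (X : 'M[C]_(n, m)) : bool :=
  [&& M *m X *m M == M, X *m M *m X == X,
      (M *m X)^t* == M *m X & (X *m M)^t* == X *m M].

Lemma trCmx_mul (C : numClosedFieldType) (m n p : nat)
    (A : 'M[C]_(m, n)) (B : 'M[C]_(n, p)) :
  (A *m B)^t* = B^t* *m A^t*.
Proof. by rewrite trmx_mul map_mxM. Qed.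

Lemma mulmx_trC_eq0 (C : numClosedFieldType) (m n : nat) (A : 'M[C]_(m, n)) :
  A *m A^t* = 0 -> A = 0.
Proof.
move=> /matrixP AA0; apply/matrixP => i j; move/eqP: (AA0 i i).
rewrite !mxE psumr_eq0 => [/allP/(_ j (mem_index_enum _))|k _].
  by rewrite !mxE mul_conjC_eq0 => /eqP.
by rewrite !mxE mul_conjC_ge0.
Qed.

Lemma mulmx_trC_unit (C : numClosedFieldType) (m n : nat) (G : 'M[C]_(m, n)) :
  row_free G -> G *m G^t* \in unitmx.
Proof.
move=> fG; rewrite -row_free_unit -kermx_eq0; set K := kermx _.
rewrite -(mulmx_free_eq0 _ fG); apply/eqP/mulmx_trC_eq0.
by rewrite trCmx_mul mulmxA -(mulmxA K) mulmx_ker mul0mx.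
Qed.

Lemma is_MP_factor (C : numClosedFieldType) (m n r : nat)
    (F : 'M[C]_(m, r)) (G : 'M[C]_(r, n)) :
  F^t* *m F \in unitmx -> G *m G^t* \in unitmx ->
  is_MP (F *m G) (G^t* *m invmx (G *m G^t*) *m (invmx (F^t* *m F) *m F^t*)).
Proof.
move=> uF uG; set P := invmx (G *m _); set Q := invmx (_ *m F).
set X := _ *m _ *m _.
have GP : G *m (G^t* *m P) = 1%:M by rewrite mulmxA mulmxV.
have QF : (Q *m F^t*) *m F = 1%:M by rewrite -mulmxA mulVmx.
have MX : F *m G *m X = F *m (Q *m F^t*).
  by rewrite /X -(mulmxA F) (mulmxA G) GP mul1mx.
have XM : X *m (F *m G) = G^t* *m P *m G.
  by rewrite /X -[LHS]mulmxA (mulmxA _ F) QF mul1mx.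
have invC p (S : 'M[C]_p) : S^t* = S -> (invmx S)^t* = invmx S.
  by move=> hS; rewrite trmx_inv map_invmx hS.
have hP : P^t* = P by rewrite invC // trCmx_mul trmxCK.
have hQ : Q^t* = Q by rewrite invC // trCmx_mul trmxCK.
apply/and4P; split; apply/eqP.
- by rewrite MX -[LHS]mulmxA (mulmxA _ F) QF mul1mx.
- by rewrite XM -(mulmxA _ G) (mulmxA G) GP mul1mx.
- by rewrite MX !trCmx_mul trmxCK hQ mulmxA.
- by rewrite XM !trCmx_mul trmxCK hP mulmxA.
Qed.

Lemma is_MP_exists (C : numClosedFieldType) (m n : nat) (M : 'M[C]_(m, n)) :
  exists X, is_MP M X.
Proof.
suff [uF uG] : (col_base M)^t* *m col_base M \in unitmx /\
               row_base M *m (row_base M)^t* \in unitmx.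
  by have := is_MP_factor uF uG; rewrite mulmx_base => ?; eexists; eassumption.
split; last by rewrite mulmx_trC_unit ?row_base_free.
rewrite -{2}[col_base M]trmxCK; apply: mulmx_trC_unit.
by rewrite row_free_map /row_free mxrank_tr; exact: col_base_full.
Qed.

(* The Moore-Penrose inverse: the only solution of the four Penrose equations
   [is_MP], by [is_MP_uniq]. *)
Definition mpinv (C : numClosedFieldType) (m n : nat) (M : 'M[C]_(m, n)) :
    'M[C]_(n, m) :=
  xchoose (is_MP_exists M).

Lemma mpinvP (C : numClosedFieldType) (m n : nat) (M : 'M[C]_(m, n)) :
  is_MP M (mpinv M).
Proof. exact: xchooseP. Qed.

Lemma is_MP_uniq (C : numClosedFieldType) (m n : nat) (M : 'M[C]_(m, n))
    (X : 'M[C]_(n, m)) :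
  is_MP M X -> X = mpinv M.
Proof.
move: (mpinv M) (mpinvP M) => Y.
case/and4P=> /eqP MYM /eqP YMY /eqP hMY /eqP hYM.
case/and4P=> /eqP MXM /eqP XMX /eqP hMX /eqP hXM.
have eMXY : M *m X = M *m Y.
  by rewrite -hMX -{1}MYM -mulmxA trCmx_mul hMX hMY mulmxA MXM.
have eXYM : X *m M = Y *m M.
  rewrite -hXM -{1}MYM -(mulmxA M) mulmxA trCmx_mul hXM hYM.
  by rewrite -mulmxA (mulmxA M) MXM.
by rewrite -XMX -mulmxA eMXY mulmxA eXYM YMY.
Qed.

(* Written A^(B): the generalized inverse of [A] with respect to [B]. *)
Definition ginv (C : numClosedFieldType) (n : nat) (A B : 'M[C]_n) : 'M[C]_n :=
  mpinv (A *m B *m mpinv B).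

(* Main.v *)
Require Import Defs.
Import Order.TTheory GRing.Theory Num.Theory.
Local Open Scope classical_set_scope.
Local Open Scope ring_scope.
Local Open Scope sesquilinear_scope.
Local Open Scope complex_scope.

(** Write [C] for [A B B^+].  The Penrose equations give
    [C^+^* = C C^+ C^+^*], whose left factor [C] is a right multiple of [A B];
    hence [C^+] satisfies the range condition.  For uniqueness, the difference
    [D] of two solutions satisfies [D A = 0] and, as an inclusion of ranges is
    a factorization ([mxrange_subP]), [D^* = A B W] for some [W].  So
    [D D^* = (D A) B W = 0], which forces [D = 0] ([mulmx_eq0_mxrange]). *)

(** An inclusion of ranges concerns one vector at a time; applied to the
    columns of [M], it yields the columns of the right factor. *)
Lemma mxrange_subP (C : numClosedFieldType) (m n p : nat)
    (M : 'M[C]_(m, n)) (N : 'M[C]_(m, p)) :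
  mxrange M `<=` mxrange N <-> exists W : 'M[C]_(p, n), M = N *m W.
Proof.
split=> [sMN | [W ->] _ [v _ <-]]; last by exists (W *m v); rewrite ?mulmxA.
have colN j : exists w : 'cV[C]_p, N *m w = col j M.
  have [|w _ Nw] := sMN (col j M); last by exists w.
  by exists (delta_mx j 0); rewrite // colE.
have [w Nw] := choice colN.
exists (\matrix_(k, j) w j k 0); apply/matrixP => i j.
move/matrixP/(_ i 0): (Nw j); rewrite !mxE => <-.
by apply: eq_bigr => k _; rewrite !mxE.
Qed.

(** The columns of [D^*] are orthogonal to the range of [A] by the first
    hypothesis and belong to it by the second. *)
Lemma mulmx_eq0_mxrange (C : numClosedFieldType) (m n p : nat)
    (D : 'M[C]_(m, n)) (A : 'M[C]_(n, p)) :
  D *m A = 0 -> mxrange (D^t*) `<=` mxrange A -> D = 0.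
Proof.
move=> DA0 /mxrange_subP[W eD]; apply: mulmx_trC_eq0.
by rewrite eD mulmxA DA0 mul0mx.
Qed.

(** Conjugate-transposing [X M X = X] turns the Hermitian factor [M X] into a
    left factor of [X^*], which exhibits [X^*] as a right multiple of [M]. *)
Lemma trC_mpinvE (C : numClosedFieldType) (m n : nat) (M : 'M[C]_(m, n)) :
  (mpinv M)^t* = M *m (mpinv M *m (mpinv M)^t*).
Proof.
case/and4P: (mpinvP M) => _ /eqP XMX /eqP hMX _.
by rewrite -{1}XMX -mulmxA trCmx_mul hMX mulmxA.
Qed.

Theorem theorem4p1 (R : realType) (n : nat) (A B : 'M[R[i]]_n) :
  unique
    (fun X : 'M[R[i]]_n =>
       X *m A = mpinv (A *m B *m mpinv B) *m A /\
       mxrange (X^t*) `<=` mxrange (A *m B))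
    (ginv A B).
Proof.
have [W eW] : exists W, (ginv A B)^t* = A *m B *m W.
  by rewrite /ginv trC_mpinvE -(mulmxA (A *m B)); eexists.
split=> [|X [XA /mxrange_subP[V eV]]].
  by split=> //; apply/mxrange_subP; exists W.
apply/eqP; rewrite -subr_eq0; apply/eqP.
apply: (@mulmx_eq0_mxrange _ _ _ _ _ A); first by rewrite mulmxBl XA subrr.
apply/mxrange_subP; exists (B *m (W - V)).
by rewrite linearB /= map_mxB eW eV mulmxA mulmxBr.
Qed.
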